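(* $\mathrm{SC}_\emptyset$-directed tree-width is not closed under taking butterfly minors: there exist finite simple digraphs $D$ and $D'$ such that $D'$ is a butterfly minor of $D$ and $\mathrm{SC}_\emptyset(D') > \mathrm{SC}_\emptyset(D)$.
   Context: All digraphs are finite and simple. An edge $(u,v)$ is butterfly contractible if it is the only edge with tail $u$ or the only edge with head $v$; a butterfly minor of $D$ is a digraph obtained from a subgraph of $D$ by contracting butterfly contractible edges. An abstract digraph decomposition of $D$ is a triple $(T,\beta,\gamma)$ with $T$ a rooted directed tree (edges directed away from the root), $\beta:V(T)\to 2^{V(D)}$, $\gamma:E(T)\to 2^{V(D)}$, $\bigcup_t\beta(t)=V(D)$. Let $\Gamma(t)=\beta(t)\cup\bigcup_{e\text{ incident with }t}\gamma(e)$, $T_t$ the subtree of nodes reachable from $t$, $\beta(T_t)=\bigcup_{t'\in V(T_t)}\beta(t')$; width $=\max_t|\Gamma(t)|-1$. An $\mathrm{SC}_\emptyset$-directed tree decomposition is an abstract digraph decomposition such that (1) $\{\beta(t)\}$ is a partition of $V(D)$ into possibly empty sets with $\beta(r)\ne\emptyset$ for the root $r$; (2) for every $e=(s,t)\in E(T)$, $\beta(T_t)$ is the vertex set of a strong component of $D-\gamma(e)$; (3) $|V(T)|\le|V(D)|^2$. $\mathrm{SC}_\emptyset(D)$ is the minimum width of such a decomposition. *)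

(* Defs.v *)
From HB Require Import structures.
From mathcomp Require Import all_boot.

Set Implicit Arguments.
Unset Strict Implicit.
Unset Printing Implicit Defensive.

(* A pair of opposite edges (a 2-cycle) is allowed in a simple digraph. *)
Record digraph := Digraph {
  vertex :> finType;
  edge : rel vertex;
  edge_irr : irreflexive edge
}.

Definition isomorphic (G H : digraph) : Prop :=
  exists2 f : G -> H, bijective f & forall x y, edge (f x) (f y) = edge x y.

(* Up to isomorphism, and not necessarily induced. *)
Definition subgraph (H D : digraph) : Prop :=
  exists2 f : H -> D, injective f & forall x y, edge x y -> edge (f x) (f y).

Definition butterfly_contractible (D : digraph) (u v : D) : bool :=
  edge u v &&
  ([forall w, edge u w ==> (w == v)] || [forall w, edge w v ==> (w == u)]).

(* In the contraction of (u, v), the vertex u plays the role of the vertex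
   obtained by identifying u and v; loops and parallel edges are discarded. *)
Section Contract.
Variables (D : digraph) (u v : D).

Definition merge (x : D) : D := if x == v then u else x.

Definition contract_vertex : finType := {x : D | x != v}.

Definition contract_edge : rel contract_vertex := fun a b =>
  (a != b) &&
  [exists x : D, exists y : D,
     [&& merge x == val a, merge y == val b & edge x y]].

Lemma contract_edge_irr : irreflexive contract_edge.
Proof. by move=> a; rewrite /contract_edge eqxx. Qed.

Definition contract : digraph := Digraph contract_edge_irr.

End Contract.

Inductive butterfly_contracts_to (D' : digraph) : digraph -> Prop :=
| Contracts_iso (D : digraph) : isomorphic D D' -> butterfly_contracts_to D' D
| Contracts_step (D : digraph) (u v : D) :
    butterfly_contractible u v ->
    butterfly_contracts_to D' (contract u v) ->
    butterfly_contracts_to D' D.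

Definition butterfly_minor (D' D : digraph) : Prop :=
  exists2 H : digraph, subgraph H D & butterfly_contracts_to D' H.

Definition strong (D : digraph) (C : {set D}) : bool :=
  (C != set0) &&
  [forall x in C, forall y in C,
     connect (fun a b => [&& a \in C, b \in C & edge a b]) x y].

(* C is the vertex set of a strong component of D - X. *)
Definition strong_component (D : digraph) (X C : {set D}) : bool :=
  maxset (fun A : {set D} => (A \subset ~: X) && strong A) C.

Definition rooted_tree (N : finType) (r : N) (e : rel N) : Prop :=
  [/\ forall s, ~~ e s r,
      forall t, t != r -> #|[set s | e s t]| = 1
    & forall t, connect e r t].

(* The values of guard outside the edges of the tree are irrelevant. *)
Record decomposition (D : digraph) := Decomposition {
  node : finType;
  root : node;
  tedge : rel node;
  bag : node -> {set D};
  guard : node -> node -> {set D};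
  tree_ok : rooted_tree root tedge;
  bag_cover : \bigcup_t bag t = [set: D]
}.

Section Width.
Variables (D : digraph) (A : decomposition D).

Definition Gamma (t : node A) : {set D} :=
  bag t :|: \bigcup_(s | tedge s t) guard s t
        :|: \bigcup_(s | tedge t s) guard t s.

Definition subtree_bag (t : node A) : {set D} :=
  \bigcup_(t' | connect (@tedge _ A) t t') bag t'.

(* The truncated predecessor is only used where some Gamma t is nonempty. *)
Definition width : nat := (\max_(t : node A) #|Gamma t|).-1.

Definition SC_decomposition : Prop :=
  [/\ forall s t : node A, s != t -> [disjoint bag s & bag t],
      bag (root A) != set0,
      forall s t : node A, tedge s t ->
        strong_component (guard s t) (subtree_bag t)
    & #|node A| <= #|D| ^ 2].

End Width.

(* SC_width D k: the minimum defining the SC-directed tree-width of D is k.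
   No k qualifies when D has no vertex, since the root bag is nonempty. *)
Definition SC_width (D : digraph) (k : nat) : Prop :=
  (exists2 A : decomposition D, SC_decomposition A & width A = k) /\
  (forall A : decomposition D, SC_decomposition A -> k <= width A).

(* Main.v *)
From Stdlib Require Import Classical_Prop.
Require Import Defs.
From mathcomp Require Import all_boot.

Set Implicit Arguments.
Unset Strict Implicit.
Unset Printing Implicit Defensive.

(* The obstruction is the nonempty root bag.  Let [D'] be the digraph on
   0, ..., 21 given by [adjacency] below, and [D] be [D'] plus an isolated vertex 22.
   - [V(D')] splits into [C1 = {0..10}] and [C2 = {11..21}]; the only edge from [C1]
     to [C2] is [6 -> 21], so the guard [{21}] isolates [C1] and the guard [{6}]
     isolates [C2].  A root with an EMPTY bag can use both guards at once, and from
     there [C1] and [C2] are decomposed with 3 guarding vertices per node.  In [D] the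
     root can hold 22, with one child whose guard is empty and whose bag is empty,
     so [D] has width at most 2.
   - In [D'] the root bag contains some [r].  A decomposition of width 2 would then
     make every strong component of [D' - r] "good", where the good pairs [(X, C)],
     with [C] a strong component of [D' - X] and [|X| <= 3], form the least family
     such that [(X, C)] is good as soon as, for some [G] containing [X] with
     [|G| <= 3], every vertex of [C] outside [G] lies in some [K] disjoint from [X]
     with [(Y, K)] good and [Y] inside [G].  (The children need not be disjoint
     from one another here: this only makes more pairs good.)  A computation of
     this fixpoint shows that every [D' - r] has a component that is not good. *)

(** * Guards and good positions *)

Section StrongComponents.
Variable D : digraph.
Implicit Types (X K : {set D}) (u v : D).

Definition avoiding X : rel D := fun a b => [&& a \notin X, b \notin X & edge a b].

Definition scc X v : {set D} :=
  [set w | connect (avoiding X) v w && connect (avoiding X) w v].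

Lemma strong_connect X K u v :
  K \subset ~: X -> strong K -> u \in K -> v \in K -> connect (avoiding X) u v.
Proof.
move=> /subsetP KX /andP[_ /forall_inP sK] uK vK.
apply: connect_sub (forall_inP (sK u uK) v vK) => a b /and3P[aK bK ab].
by apply: connect1; move: (KX a aK) (KX b bK); rewrite !inE /avoiding ab => -> ->.
Qed.

Lemma scc_refl X v : v \in scc X v.
Proof. by rewrite inE connect0. Qed.

Lemma scc_sub X v : v \notin X -> scc X v \subset ~: X.
Proof.
move=> vX; apply/subsetP => w; rewrite !inE => /andP[/connectP[p]].
elim/last_ind: p => [|p x _] /=; first by move=> _ ->.
by rewrite rcons_path last_rcons => /andP[_ /and3P[_ xX _]] ->.
Qed.

(** A walk between two vertices of the class never leaves it: every intermediate vertex is reached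
    from [v] and reaches [v]. *)
Lemma strong_scc X v : strong (scc X v).
Proof.
apply/andP; split; first by apply/set0Pn; exists v; apply: scc_refl.
apply/forall_inP => x xS; apply/forall_inP => y yS.
have : connect (avoiding X) x y.
  by move: xS yS; rewrite !inE => /andP[_ xv] /andP[vy _]; apply: connect_trans vy.
case/connectP => p; elim: p x xS => [|z p IHp] x xS /=; first by move=> _ ->.
case/andP => xz pzp Dy.
have zS: z \in scc X v.
  move: xS yS; rewrite !inE => /andP[vx _] /andP[_ yv].
  rewrite (connect_trans vx (connect1 xz)) /=; apply: connect_trans yv.
  by apply/connectP; exists p.
apply: connect_trans (IHp z zS pzp Dy).
by apply: connect1; case/and3P: xz => _ _ ->; rewrite xS zS.
Qed.

Lemma scc_strong_component X v : v \notin X -> strong_component X (scc X v).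
Proof.
move=> vX; apply/maxsetP; split=> [|B /andP[BX sB] SB].
  by rewrite scc_sub // strong_scc.
apply/eqP; rewrite eqEsubset SB andbT; apply/subsetP => w wB; rewrite inE.
by rewrite !(strong_connect BX sB) // (subsetP SB) ?scc_refl.
Qed.

Lemma strong_componentE X K v : strong_component X K -> v \in K -> K = scc X v.
Proof.
case/maxsetP => /andP[KX sK] maxK vK; have vX: v \notin X.
  by have /subsetP/(_ v vK) := KX; rewrite inE.
apply/esym/maxK; first by rewrite scc_sub // strong_scc.
by apply/subsetP => w wK; rewrite inE !(strong_connect KX sK).
Qed.

End StrongComponents.

Section RootedTrees.
Variables (N : finType) (r : N) (e : rel N).
Hypothesis e_tree : rooted_tree r e.

Lemma root_unreachable s : connect e s r -> s = r.
Proof.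
case: e_tree => noin _ _ /connectP[p]; elim/last_ind: p => [|p x _] //=.
by rewrite rcons_path last_rcons => /andP[_ sx] Dx; rewrite -Dx (negPf (noin _)) in sx.
Qed.

Lemma parent_unique s s' t : e s t -> e s' t -> s = s'.
Proof.
case: e_tree => noin one _ st s't.
have tr: t != r by apply: contraTneq st => ->.
have /eqP/cards1P[x Dx] := one t tr.
have: s \in [set x] by rewrite -Dx inE.
have: s' \in [set x] by rewrite -Dx inE.
by rewrite !inE => /eqP-> /eqP.
Qed.

(** Parents are unique, so a cycle through [s] also passes through the parent of [s]. Induction
    along the path from the root moves the cycle up to the root, which has no entering edge. *)
Lemma tree_acyclic s t : e s t -> ~~ connect e t s.
Proof.
case: (e_tree) => noin _ conn; have /connectP[p] := conn s.
elim/last_ind: p s t => [|p z IHp] s t /=.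
  move=> _ -> rt; apply/negP => /root_unreachable tr.
  by rewrite tr (negPf (noin r)) in rt.
rewrite rcons_path last_rcons => /andP[rp ez] -> {s} zt; apply/negP => tz.
suff: connect e z (last r p) by apply/negP/IHp.
apply: connect_trans (connect1 zt) _; case/connectP: tz => q.
elim/last_ind: q => [|q y _] /=.
  by move=> _ Dz; subst z; rewrite (parent_unique ez zt).
rewrite rcons_path last_rcons => /andP[tq ey] Dy.
by rewrite Dy in ez; rewrite (parent_unique ez ey); apply/connectP; exists q.
Qed.

End RootedTrees.

Section Positions.
Variables (D : digraph) (k : nat) (good : {set D} -> {set D} -> Prop).

(* [settled G X v]: with the guards [Y] available inside [G], the vertex [v] is
   taken care of by a child of a position whose guard is [X]. *)
Definition settled (G X : {set D}) (v : D) : Prop :=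
  exists Y K : {set D},
    [/\ Y \subset G, strong_component Y K, good Y K, v \in K & [disjoint K & X]].

(** [good] stays abstract: the flags of a computed table are substituted for it later, and closure
    under this rule is checked on the table itself. *)
Hypothesis good_closed : forall G X C : {set D},
  #|G| <= k -> X \subset G -> strong_component X C ->
  (forall v, v \in C -> v \notin G -> settled G X v) -> good X C.

Variable A : decomposition D.
Hypotheses (A_SC : SC_decomposition A) (A_small : forall t : node A, #|Gamma t| <= k).

Lemma subtree_bagP (t : node A) v :
  reflect (exists2 t', connect (@tedge _ A) t t' & v \in bag t') (v \in subtree_bag t).
Proof. by apply: (iffP bigcupP) => -[t' tt' vt']; exists t'. Qed.

Lemma bag_Gamma (t : node A) : bag t \subset Gamma t.
Proof. by rewrite /Gamma -setUA subsetUl. Qed.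

Lemma guard_Gamma_child (s t : node A) : tedge s t -> guard s t \subset Gamma t.
Proof.
move=> st; rewrite /Gamma; apply: subset_trans (subsetUl _ _).
by apply: subset_trans (subsetUr _ _); apply: (bigcup_sup s).
Qed.

Lemma guard_Gamma_parent (s t : node A) : tedge s t -> guard s t \subset Gamma s.
Proof. by move=> st; apply: subset_trans (subsetUr _ _); apply: (bigcup_sup t). Qed.

Lemma subtree_bag_child (t : node A) v :
  v \in subtree_bag t -> v \notin Gamma t ->
  exists2 t', tedge t t' & v \in subtree_bag t'.
Proof.
case/subtree_bagP => t'' /connectP[[|t' p]] /=; first by move=> _ -> /(subsetP (bag_Gamma t)) ->.
case/andP => tt' t'p Dt'' vt'' _; exists t' => //; apply/subtree_bagP; exists t'' => //.
by apply/connectP; exists p.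
Qed.

Lemma subtree_bagS (s t : node A) : tedge s t -> subtree_bag t \subset subtree_bag s.
Proof.
move=> st; apply/subsetP => v /subtree_bagP[t' tt' vt']; apply/subtree_bagP.
by exists t' => //; apply: connect_trans (connect1 st) tt'.
Qed.

(** Induction on the number of nodes below [t], with [G := Gamma t]: it contains the guards of all
    edges at [t], and a vertex of the component outside [G] lies below a child of [t]. *)
Lemma good_subtree (s t : node A) : tedge s t -> good (guard s t) (subtree_bag t).
Proof.
case: A_SC => _ _ SC _.
have [m] := ubnP #|connect (@tedge _ A) t|; elim: m s t => // m IHm s t le_m st.
apply: good_closed (A_small t) (guard_Gamma_child st) (SC _ _ st) _ => v vC vG.
have [t' tt' vt'] := subtree_bag_child vC vG.
exists (guard t t'), (subtree_bag t'); split=> //.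
- exact: guard_Gamma_parent.
- exact: SC.
- apply: (IHm _ _ _ tt'); rewrite -ltnS; apply: leq_trans le_m; rewrite ltnS.
  apply/proper_card/properP; split.
    by apply/subsetP => x; apply: connect_trans (connect1 tt').
  by exists t; [apply: connect0 | apply: (tree_acyclic (tree_ok A))].
(* The part below the child lies in the component at [t], which avoids [guard s t]. *)
rewrite disjoint_subset; apply: subset_trans (subtree_bagS tt') _.
by have /maxsetP[/andP[/subsetP sub _] _] := SC _ _ st; apply/subsetP => x /sub; rewrite inE.
Qed.

Lemma good_root : exists (G : {set D}) (r : D),
  [/\ #|G| <= k, r \in G & forall v, v \notin G -> settled G [set r] v].
Proof.
case: A_SC => disj /set0Pn[r r_root] SC _; exists (Gamma (Defs.root A)), r.
split=> [||v vG]; rewrite ?A_small ?(subsetP (bag_Gamma _)) //.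
have vC: v \in subtree_bag (Defs.root A).
  have: v \in \bigcup_(t : node A) bag t by rewrite bag_cover inE.
  case/bigcupP => t _ vt; apply/subtree_bagP; exists t => //.
  by case: (tree_ok A).
have [t tt vt] := subtree_bag_child vC vG.
exists (guard (Defs.root A) t), (subtree_bag t); split; rewrite ?guard_Gamma_parent ?SC //.
  exact: good_subtree.
(* Bags are disjoint, so [r] could lie below the child [t] only if the root did, which would close a
   cycle. *)
rewrite disjoint_sym disjoints1; apply/subtree_bagP => -[t' t_t' rt'].
have [Dt' | /disj/disjointFr/(_ rt')] := eqVneq t' (Defs.root A); last by rewrite r_root.
by have := tree_acyclic (tree_ok A) tt; rewrite -Dt' t_t'.
Qed.

End Positions.

(** * Vertex sets as bit masks *)

(** Masks are read with [nth false]: bits past the end count as absent, so masks of different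
    lengths can be combined. *)
Fixpoint join (s t : bitseq) : bitseq :=
  match s, t with
  | b :: s', c :: t' => (b || c) :: join s' t'
  | [::], _ => t
  | _, [::] => s
  end.

Fixpoint meet (s t : bitseq) : bitseq :=
  match s, t with
  | b :: s', c :: t' => (b && c) :: meet s' t'
  | _, _ => [::]
  end.

Fixpoint minus (s t : bitseq) : bitseq :=
  match s, t with
  | b :: s', c :: t' => (b && ~~ c) :: minus s' t'
  | _, _ => s
  end.

Fixpoint within (s t : bitseq) : bool :=
  match s, t with
  | b :: s', c :: t' => (b ==> c) && within s' t'
  | _, [::] => ~~ has id s
  | [::], _ => true
  end.

Fixpoint apart (s t : bitseq) : bool :=
  match s, t with
  | b :: s', c :: t' => ~~ (b && c) && apart s' t'
  | _, _ => true
  end.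

Fixpoint successors (rows : seq bitseq) (r : bitseq) : bitseq :=
  match rows, r with
  | a :: rows', b :: r' => if b then join a (successors rows' r') else successors rows' r'
  | _, _ => [::]
  end.

Fixpoint grow (m : nat) (rows : seq bitseq) (a r : bitseq) : bitseq :=
  if m is m'.+1 then
    let r' := meet a (successors rows r) in
    if within r' r then r else grow m' rows a (join r r')
  else r.

(** A binary trie: the bit of a mask at position [i] selects the branch at depth [i]. *)
Inductive table (T : Type) := Leaf of T | Node of table T & table T.

Section Tables.
Variables (T : Type) (d : T).

(* Subsets with more than [k] elements get the default value. *)
Fixpoint tabulate (k n : nat) (f : bitseq -> T) : table T :=
  if n is n'.+1 then
    Node (tabulate k n' (f \o cons false))
         (if k is k'.+1 then tabulate k' n' (f \o cons true) else Leaf d)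
  else Leaf (f [::]).

Fixpoint lookup (t : table T) (s : bitseq) : T :=
  match t, s with
  | Leaf x, _ => x
  | Node l r, b :: s' => lookup (if b then r else l) s'
  | Node _ _, [::] => d
  end.

Fixpoint update (f : T -> T) (t : table T) (s : bitseq) : table T :=
  match t, s with
  | Leaf x, _ => Leaf (f x)
  | Node l r, b :: s' => if b then Node l (update f r s') else Node (update f l s') r
  | Node _ _, [::] => t
  end.

End Tables.

Fixpoint small_masks (k n : nat) : seq bitseq :=
  if n is n'.+1 then
    map (cons false) (small_masks k n') ++
    (if k is k'.+1 then map (cons true) (small_masks k' n') else [::])
  else [:: [::]].

Fixpoint submasks (s : bitseq) : seq bitseq :=
  if s is b :: s' then
    let m := submasks s' in
    map (cons false) m ++ (if b then map (cons true) m else [::])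
  else [:: [::]].

Section Solver.
Variables (n : nat) (e : rel nat).

Definition mask_edge : rel 'I_n := [rel i j : 'I_n | (i != j) && e i j].

Lemma mask_edge_irr : irreflexive mask_edge.
Proof. by move=> i; apply/negP => /andP[/eqP]. Qed.

Definition mask_digraph : digraph := Digraph mask_edge_irr.

Definition rows_of (R : rel nat) : seq bitseq := mkseq (fun i => mkseq (R i) n) n.
Definition out_rows : seq bitseq := rows_of (fun i j => (i != j) && e i j).
Definition in_rows : seq bitseq := rows_of (fun i j => (j != i) && e j i).

Definition unit_mask (i : nat) : bitseq := mkseq (pred1 i) n.
Definition compl_mask (s : bitseq) : bitseq := mkseq (fun i => ~~ nth false s i) n.

Section Rows.
Variables outs ins : seq bitseq.

Definition scc_mask (a : bitseq) (i : nat) : bitseq :=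
  meet (grow n outs a (unit_mask i)) (grow n ins a (unit_mask i)).

(** [rest] holds the vertices of [a] not yet in a listed component. *)
Fixpoint scc_masks (vs : seq nat) (a rest : bitseq) : seq bitseq :=
  if vs is v :: vs' then
    if nth false rest v then
      let c := scc_mask a v in c :: scc_masks vs' a (minus rest c)
    else scc_masks vs' a rest
  else [::].

Definition components (x : bitseq) : seq bitseq :=
  let a := compl_mask x in scc_masks (iota 0 n) a a.

End Rows.

End Solver.

(* A position is a strong component of [D - x], flagged [true] once it is known
   to be good; a table maps every small guard [x] to its positions. *)
Definition positions : Type := seq (bitseq * bool).

Definition goods (t : table positions) (g : bitseq) : seq bitseq :=
  flatten [seq [seq p.1 | p <- lookup [::] t y & p.2] | y <- submasks g].

(* The first test is implied by the second; it is there because it is cheap. *)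
Definition covered (g x : bitseq) (ks : seq bitseq) (all_ks c : bitseq) : bool :=
  within c all_ks && within c (foldr join g [seq k <- ks | apart k x]).

Definition settle (t : table positions) (g : bitseq) : table positions :=
  let ks := goods t g in
  let all_ks := foldr join g ks in
  foldl (fun t x => update (map (fun p => (p.1, p.2 || covered g x ks all_ks p.1))) t x)
    t (submasks g).

(** Closure of the flags under the rule for good positions. Testing it on the final table replaces a
    proof that the iteration has stabilised. The bound on [size p.1] ensures that every set bit is a
    vertex. *)
Definition settled_table (n k : nat) (t : table positions) : bool :=
  all (fun g =>
      let ks := goods t g in
      let all_ks := foldr join g ks in
      all (fun x => all (fun p => p.2 || (size p.1 <= n) && ~~ covered g x ks all_ks p.1)
                        (lookup [::] t x))
          (submasks g))
    (small_masks k n).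

Definition initial_table (n : nat) (e : rel nat) (k : nat) : table positions :=
  let outs := out_rows n e in
  let ins := in_rows n e in
  tabulate [::] k n (fun x => [seq (c, false) | c <- components n outs ins x]).

Definition solve (n : nat) (e : rel nat) (m k : nat) : table positions :=
  iter m (fun t => foldl settle t (small_masks k n)) (initial_table n e k).

Definition no_good_root (n : nat) (e : rel nat) (m k : nat) : bool :=
  let t := solve n e m k in
  settled_table n k t &&
  all (fun r => has (fun p => ~~ p.2) (lookup [::] t (unit_mask n r))) (iota 0 n).

Lemma nth_join s t i : nth false (join s t) i = nth false s i || nth false t i.
Proof. by elim: s t i => [|b s IHs] [|c t] [|i] //=; rewrite ?nth_nil ?orbF ?IHs. Qed.

Lemma nth_meet s t i : nth false (meet s t) i = nth false s i && nth false t i.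
Proof. by elim: s t i => [|b s IHs] [|c t] [|i] //=; rewrite ?nth_nil ?andbF ?IHs. Qed.

Lemma nth_minus s t i : nth false (minus s t) i = nth false s i && ~~ nth false t i.
Proof. by elim: s t i => [|b s IHs] [|c t] [|i] //=; rewrite ?nth_nil ?andbT ?IHs. Qed.

Lemma withinP s t : reflect (forall i, nth false s i -> nth false t i) (within s t).
Proof.
elim: s t => [|b s IHs] [|c t]; try by constructor=> i; rewrite nth_nil.
- rewrite /= -[~~ _]/(~~ has id (b :: s)).
  apply: (iffP hasPn) => [s0 i si | H x /(nthP false)[i _ <-]]; last first.
    by apply/negP => /H; rewrite nth_nil.
  have ltis: i < size (b :: s) by case: ltnP si => // /(nth_default false) ->.
  by have /negP := s0 _ (mem_nth false ltis).
- apply: (iffP andP) => [[/implyP bc /IHs st] [|i] //=|H]; first exact: st.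
  by split; [apply/implyP/(H 0) | apply/IHs => i; apply: (H i.+1)].
Qed.

Lemma apartP s t : reflect (forall i, nth false s i -> ~~ nth false t i) (apart s t).
Proof.
elim: s t => [|b s IHs] [|c t] /=; try by constructor => i; rewrite ?nth_nil.
apply: (iffP andP) => [[/nandP bc /IHs st] [|i] //=|H].
- by move=> b1; case: bc => //; rewrite b1.
- exact: st.
split; last by apply/IHs => i; apply: (H i.+1).
by apply/nandP; case: b H => H; [right; apply: (H 0) | left].
Qed.

Lemma nth_successors rows r i :
  nth false (successors rows r) i = has (fun j => nth false r j && nth false (nth [::] rows j) i)
                                   (iota 0 (size rows)).
Proof.
elim: rows r => [|a rows IHrows] [|b r] /=; rewrite ?nth_nil //.
  by elim: (iota 1 _) => //= x l <-; rewrite nth_nil.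
rewrite -[1]addn0 iotaDl has_map (eq_has (a2 := fun j => nth false r j && nth false (nth [::] rows j) i)) -?IHrows //.
by case: b; rewrite ?nth_join.
Qed.

Section Masks.
Variable n : nat.

Definition vset (s : bitseq) : {set 'I_n} := [set i : 'I_n | nth false s i].
Definition mask_of (S : {set 'I_n}) : bitseq := [seq i \in S | i <- enum 'I_n].

Lemma size_mask_of S : size (mask_of S) = n.
Proof. by rewrite size_map size_enum_ord. Qed.

Lemma nth_mask_of (S : {set 'I_n}) (i : 'I_n) : nth false (mask_of S) i = (i \in S).
Proof. by rewrite (nth_map i) ?size_enum_ord // nth_ord_enum. Qed.

Lemma nth_mask_ofP (S : {set 'I_n}) (j : nat) : reflect (exists2 i : 'I_n, j = i & i \in S) (nth false (mask_of S) j).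
Proof.
case: (ltnP j n) => [ltjn | lenj].
  have -> := nth_mask_of S (Ordinal ltjn); apply: (iffP idP) => [jS | [i Dj iS]].
    by exists (Ordinal ltjn).
  by rewrite (_ : Ordinal ltjn = i) //; apply: val_inj.
rewrite nth_default ?size_mask_of //; constructor=> -[i Dj _].
by rewrite Dj leqNgt ltn_ord in lenj.
Qed.

Lemma mask_ofK S : vset (mask_of S) = S.
Proof. by apply/setP => i; rewrite inE nth_mask_of. Qed.

Lemma within_mask_of (S S' : {set 'I_n}) : S \subset S' -> within (mask_of S) (mask_of S').
Proof.
move=> /subsetP SS'; apply/withinP => j /nth_mask_ofP[i -> iS].
by rewrite nth_mask_of SS'.
Qed.

Lemma count_mask_of (S : {set 'I_n}) : count id (mask_of S) = #|S|.
Proof.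
rewrite count_map -sum1_count big_enum_cond /= -sum1_card.
by apply: eq_bigl.
Qed.

Lemma unit_mask_set (r : 'I_n) : unit_mask n r = mask_of [set r].
Proof.
apply: (@eq_from_nth _ false) => [|i]; rewrite size_mkseq ?size_mask_of // => ltin.
by rewrite nth_mkseq //; have -> := nth_mask_of [set r] (Ordinal ltin); rewrite !inE.
Qed.

End Masks.

Lemma mem_small_masks k n s : size s = n -> count id s <= k -> s \in small_masks k n.
Proof.
elim: n k s => [|n IHn] k [|b s] //= [sz]; case: b => /=.
  case: k => // k; rewrite add1n ltnS => le_sk.
  by rewrite mem_cat map_f ?orbT // IHn.
by rewrite add0n => le_sk; rewrite mem_cat map_f // IHn.
Qed.

Lemma mem_submasks s t : size s = size t -> within s t -> s \in submasks t.
Proof.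
elim: t s => [|c t IHt] [|b s] //= [sz] /andP[/implyP bc st].
rewrite mem_cat; case: b bc => [->|_] //; last by rewrite map_f // IHt.
by rewrite (map_f (cons true)) ?orbT // IHt.
Qed.

Section TableTheory.
Variables (T : Type) (d : T).

Lemma lookup_tabulate k n f s :
  size s = n -> count id s <= k -> lookup d (tabulate d k n f) s = f s.
Proof.
elim: n k f s => [|n IHn] k f [|b s] //= [sz]; case: b => /=.
  by case: k => // k; rewrite add1n ltnS => le_sk; rewrite IHn.
by rewrite add0n => le_sk; rewrite IHn.
Qed.

(** Meant for [h := unzip1], which forgets the flags: settling changes flags only and leaves the
    listed components alone. *)
Lemma lookup_update (U : Type) (h : T -> U) f t s s' :
  (forall x, h (f x) = h x) -> h (lookup d (update f t s) s') = h (lookup d t s').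
Proof.
move=> hf; elim: t s s' => [x|l IHl r IHr] [|b s] [|b' s'] //=; try exact: hf.
- by case: b.
- by case: b; case: b' => /=.
Qed.

End TableTheory.

(** * Computed strong components *)

Section Reachability.
Variables (n : nat) (R : rel nat).
Notation rows := (rows_of n R).

Lemma successors_rowsP (r : bitseq) (j : 'I_n) :
  reflect (exists2 i : 'I_n, i \in vset n r & R i j) (nth false (successors rows r) j).
Proof.
rewrite nth_successors size_mkseq; apply: (iffP hasP) => [[i] | [i]].
  rewrite mem_iota /= add0n => ltin /andP[ri].
  by rewrite nth_mkseq // nth_mkseq // => Rij; exists (Ordinal ltin); rewrite ?inE.
rewrite inE => ri Rij; exists (i : nat); first by rewrite mem_iota /= add0n.
by rewrite ri !nth_mkseq.
Qed.

Variables (a : bitseq) (v : 'I_n).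
Let P : rel 'I_n := fun i j => [&& i \in vset n a, j \in vset n a & R i j].

Lemma vset_growS m r : vset n r \subset vset n (grow m rows a r).
Proof.
elim: m r => //= m IHm r; case: ifP => // _; apply: subset_trans (IHm _).
by apply/subsetP => i; rewrite !inE nth_join => ->.
Qed.

Lemma grow_sound m r : vset n r \subset [set j in vset n a | connect P v j] ->
  vset n (grow m rows a r) \subset [set j in vset n a | connect P v j].
Proof.
elim: m r => //= m IHm r sub_r; case: ifP => // _; apply/IHm/subsetP => j.
rewrite !inE nth_join nth_meet => /orP[rj | /andP[aj /successors_rowsP[i ri Rij]]].
  by have := subsetP sub_r j; rewrite !inE; apply.
have := subsetP sub_r i ri; rewrite !inE aj => /andP[ai vi].
by apply: connect_trans vi (connect1 _); rewrite /P !inE ai aj.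
Qed.

(** A round that does not stop adds a vertex, so the fuel plus the size of [r] never drops below
    [n]; when the fuel is exhausted, [r] contains every vertex. *)
Lemma grow_closed m r i j : n <= m + #|vset n r| ->
  i \in vset n (grow m rows a r) -> P i j -> j \in vset n (grow m rows a r).
Proof.
elim: m r => [|m IHm] r /=.
  rewrite add0n -{1}[n]card_ord => full _ _.
  have /eqP -> : vset n r == setT by rewrite eqEcard subsetT cardsT.
  by rewrite inE.
case: withinP => [sub_r _ ri Pij | nsub_r le_n].
  rewrite inE; apply: sub_r; rewrite nth_meet.
  case/and3P: Pij => _; rewrite inE => -> Rij.
  by apply/successors_rowsP; exists i.
apply: IHm; apply: leq_trans le_n _; rewrite addSnnS leq_add2l.
apply/proper_card/properP; split.
  by apply/subsetP => x; rewrite !inE nth_join => ->.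
have /existsP[x] : [exists x : 'I_n, (x \in vset n (meet a (successors rows r))) && (x \notin vset n r)].
  apply: contra_notT nsub_r; rewrite negb_exists => /forallP sub x rx.
  (* All rows have length [n], so a new bit is an actual vertex. *)
  have ltxn: x < n.
    move: rx; rewrite nth_meet nth_successors => /andP[_ /hasP[y _ /andP[_]]].
    case: (ltnP x n) => // lenx; rewrite nth_default //.
    by have [lty | ley] := ltnP y n; [rewrite nth_mkseq ?size_mkseq | rewrite nth_default ?size_mkseq].
  by have:= sub (Ordinal ltxn); rewrite !inE rx negbK.
case/andP => xm xr; exists x => //; move: xm.
by rewrite !inE nth_join => ->; rewrite orbT.
Qed.

Lemma vset_grow : v \in vset n a ->
  vset n (grow n rows a (unit_mask n v)) = [set j | connect P v j].
Proof.
move=> va; apply/eqP; rewrite eqEsubset; apply/andP; split.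
  have: vset n (unit_mask n v) \subset [set j in vset n a | connect P v j].
    by rewrite unit_mask_set mask_ofK sub1set inE va connect0.
  by move/(grow_sound n)/subset_trans; apply; apply/subsetP => j; rewrite !inE => /andP[].
set g := grow _ _ _ _; have gP i j : i \in vset n g -> P i j -> j \in vset n g.
  by apply: grow_closed; rewrite leq_addr.
have gv: v \in vset n g.
  by apply: (subsetP (vset_growS n _)); rewrite unit_mask_set mask_ofK inE.
apply/subsetP => j; rewrite inE => /connectP[p].
elim: p {va}v gv => [|k p IHp] i gi /=; first by move=> _ ->.
by case/andP => Pik; apply: IHp; apply: gP Pik.
Qed.

End Reachability.

Section Components.
Variables (n : nat) (e : rel nat).
Notation D := (mask_digraph n e).
Notation outs := (out_rows n e).
Notation ins := (in_rows n e).
Implicit Types (x : bitseq) (v : 'I_n).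

Lemma vset_compl x : vset n (compl_mask n x) = ~: vset n x.
Proof. by apply/setP => i; rewrite !inE nth_mkseq. Qed.

Lemma vset_scc x v : v \notin vset n x ->
  vset n (scc_mask n outs ins (compl_mask n x) v) = scc (vset n x : {set D}) v.
Proof.
move=> vx; have va : v \in vset n (compl_mask n x) by rewrite vset_compl inE.
apply/setP => w; rewrite inE nth_meet.
have -> s t : nth false s w && nth false t w = (w \in vset n s) && (w \in vset n t).
  by rewrite !inE.
rewrite /out_rows /in_rows !vset_grow // !inE; congr andb.
  by apply: eq_connect => i j; rewrite /avoiding vset_compl !inE.
(* Growing along [ins] follows edges backward and yields the vertices that reach [v]. *)
have /= <- := connect_rev (avoiding (vset n x : {set D})) v w.
by apply: eq_connect => i j; rewrite /= /avoiding vset_compl !inE andbCA.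
Qed.

(** [K] stays inside [rest] until one of its vertices is visited: the other components removed
    before are disjoint from it. *)
Lemma scc_masksP x (K : {set D}) vs rest :
  strong_component (vset n x : {set D}) K -> (forall v, v \in K -> nth false rest v) ->
  (forall i, nth false rest i -> nth false (compl_mask n x) i) ->
  (exists2 v, v \in K & (v : nat) \in vs) ->
  exists2 c, c \in scc_masks n outs ins vs (compl_mask n x) rest & vset n c = K.
Proof.
move=> KX; elim: vs rest => [|u vs IHvs] rest Krest rest_a [v vK] //=.
rewrite inE; have [<- _ | vu /= vvs] := eqVneq (v : nat) u.
  rewrite (Krest v vK); exists (scc_mask n outs ins (compl_mask n x) v).
    by rewrite inE eqxx.
  have vx : v \notin vset n x by have := rest_a _ (Krest v vK); rewrite inE nth_mkseq.
  by rewrite vset_scc // -(strong_componentE KX vK).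
case: ifP => [ru | _]; last by apply: (IHvs _ Krest rest_a); exists v.
have ltun: u < n.
  by have := rest_a _ ru; case: ltnP => // leun; rewrite nth_default ?size_mkseq.
pose w := Ordinal ltun; have [wK | wK] := boolP (w \in K).
  exists (scc_mask n outs ins (compl_mask n x) w); first by rewrite inE eqxx.
  have wx : w \notin vset n x by have := rest_a _ (Krest w wK); rewrite inE nth_mkseq.
  by rewrite vset_scc // -(strong_componentE KX wK).
have wx : w \notin vset n x by have := rest_a _ ru; rewrite inE nth_mkseq.
have [|||c c_in Dc] := IHvs (minus rest (scc_mask n outs ins (compl_mask n x) u)).
- move=> y yK; rewrite nth_minus Krest //=; apply: contra wK => yS.
  have {yS}: y \in vset n (scc_mask n outs ins (compl_mask n x) w) by rewrite inE.
  rewrite vset_scc // => yw; have wX := @scc_strong_component D (vset n x) w wx.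
  by rewrite (strong_componentE KX yK) -(strong_componentE wX yw) (@scc_refl D).
- by move=> i; rewrite nth_minus => /andP[/rest_a].
- by exists v.
by exists c; rewrite // inE c_in orbT.
Qed.

Lemma componentsP x (K : {set D}) : strong_component (vset n x : {set D}) K ->
  exists2 c, c \in components n outs ins x & vset n c = K.
Proof.
move=> KX; have /maxsetP[/andP[Kx /andP[/set0Pn[v vK] _]] _] := KX.
apply: scc_masksP => // [u uK|].
  by have := subsetP Kx u uK; rewrite !inE nth_mkseq.
by exists v => //; rewrite mem_iota /=.
Qed.

End Components.

(** * Bounding the width by computation *)

Section NoGoodRoot.
Variables (n : nat) (e : rel nat) (m k : nat).
Notation D := (mask_digraph n e).

Definition positions_at (t : table positions) (X : {set 'I_n}) : positions :=
  lookup [::] t (mask_of X).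

Lemma unzip_settle t g s :
  unzip1 (lookup [::] (settle t g) s) = unzip1 (lookup [::] t s).
Proof.
rewrite /settle; move: (goods t g) (foldr _ _ _) => ks all_ks.
elim: (submasks g) t => //= x xs IHxs t; rewrite IHxs; apply: (@lookup_update _ _ _ (@unzip1 bitseq bool)) => p.
by rewrite /unzip1 -map_comp.
Qed.

Lemma unzip_solve s : size s = n -> count id s <= k ->
  unzip1 (lookup [::] (solve n e m k) s) = components n (out_rows n e) (in_rows n e) s.
Proof.
move=> sz le_sk; rewrite /solve; elim: m => [|m' IHm] /=.
  by rewrite lookup_tabulate // /unzip1 -map_comp map_id.
elim: (small_masks k n) (iter _ _ _) IHm => //= g gs IHgs t Dt.
by apply: IHgs; rewrite unzip_settle.
Qed.

Definition table_good (t : table positions) (Y K : {set D}) : Prop :=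
  exists2 p, p \in positions_at t Y & p.2 /\ vset n p.1 = K.

Lemma nth_foldr_join g ks i :
  nth false (foldr join g ks) i = nth false g i || has (fun c => nth false c i) ks.
Proof. by elim: ks => [|c ks IHks] /=; rewrite ?orbF // nth_join IHks orbCA. Qed.

Lemma goodsP t (G : {set 'I_n}) (Y K : {set D}) : Y \subset G -> table_good t Y K ->
  exists2 c, c \in goods t (mask_of G) & vset n c = K.
Proof.
move=> YG [p pY [p2 Dp]]; exists p.1 => //; apply/flatten_mapP; exists (mask_of Y).
  by rewrite mem_submasks ?size_mask_of ?within_mask_of.
by apply: map_f; rewrite mem_filter p2.
Qed.

Lemma settled_covered t (G X : {set D}) (c : bitseq) : size c <= n ->
  (forall v : 'I_n, nth false c v -> v \notin G -> settled (table_good t) G X v) ->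
  covered (mask_of G) (mask_of X) (goods t (mask_of G))
    (foldr join (mask_of G) (goods t (mask_of G))) c.
Proof.
move=> sz_c sc; have cov i : nth false c i -> nth false (mask_of G) i ||
    has (fun d => apart d (mask_of X) && nth false d i) (goods t (mask_of G)).
  move=> ci; have ltin: i < n.
    by case: ltnP => // leni; rewrite nth_default ?(leq_trans sz_c) in ci.
  have -> := nth_mask_of G (Ordinal ltin); have [//|iG] := boolP (_ \in G).
  have [Y [K [YG _ gYK iK KX]]] := sc (Ordinal ltin) ci iG.
  have [d dG Dd] := goodsP YG gYK; apply/hasP; exists d => //.
  apply/andP; split; last by move: iK; rewrite -Dd inE.
  apply/apartP => j dj; apply/negP => /nth_mask_ofP[x Dx xX].
  by have /negP[] := disjointFl KX xX; rewrite -Dd inE -Dx.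
apply/andP; split; apply/withinP => i /cov.
  rewrite nth_foldr_join => /orP[-> // | /hasP[d dG /andP[_ di]]].
  by apply/orP; right; apply/hasP; exists d.
rewrite nth_foldr_join => /orP[-> // | /hasP[d dG /andP[dX di]]].
by apply/orP; right; apply/hasP; exists d; rewrite // mem_filter dX.
Qed.

Lemma no_good_root_width : no_good_root n e m k ->
  forall A : decomposition D, SC_decomposition A -> k <= width A.
Proof.
case/andP=> /allP closed_t /allP bad_roots A A_SC; set t := solve n e m k in closed_t bad_roots.
suff: ~~ [forall s : node A, #|Gamma s| <= k].
  case/forallPn => s; rewrite -ltnNge => lt_k.
  (* The width is a truncated predecessor, so [k < #|Gamma s|] for a single node already gives
     [k <= width A]. *)
  rewrite /width -ltnS; apply: leq_trans lt_k (leq_trans _ (leqSpred _)).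
  exact: leq_bigmax.
have flagged (G X : {set 'I_n}) p : #|G| <= k -> X \subset G -> p \in positions_at t X ->
    (forall v : 'I_n, nth false p.1 v -> v \notin G -> settled (table_good t) G X v) -> p.2.
  move=> leGk XG pX sp.
  have /closed_t/allP/(_ (mask_of X)) : mask_of G \in small_masks k n.
    by rewrite mem_small_masks ?size_mask_of ?count_mask_of.
  rewrite mem_submasks ?size_mask_of ?within_mask_of // => /(_ isT)/allP/(_ p pX).
  by case/orP => // /andP[sz_p /negP[]]; apply: settled_covered.
apply/negP => /forallP small.
have good_closed (G X C : {set D}) : #|G| <= k -> X \subset G -> strong_component X C ->
    (forall v, v \in C -> v \notin G -> settled (table_good t) G X v) -> table_good t X C.
  move=> leGk XG XC sC.
  (* The table lists every strong component under a small guard, flagged or not. *)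
  have [c c_in Dc] : exists2 c, c \in unzip1 (positions_at t X) & vset n c = C.
    rewrite unzip_solve ?size_mask_of ?count_mask_of ?(leq_trans (subset_leq_card XG)) //.
    by apply: componentsP; rewrite mask_ofK.
  have [p pX Dp] := mapP c_in; exists p; rewrite // -Dp; split=> //.
  by apply: (flagged G X) => // v cv; apply: sC; rewrite -Dc inE Dp.
have [G [r [leGk rG sr]]] := good_root good_closed A_SC small.
(* The unflagged component for the guard [[set r]] would be covered by the bag and guards at the
   root, so closure would flag it. *)
have /bad_roots/hasP[p pr /negP[]] : (r : nat) \in iota 0 n by rewrite mem_iota /=.
rewrite unit_mask_set in pr.
by apply: (flagged G [set r]) => //; rewrite ?sub1set // => v _; apply: sr.
Qed.

End NoGoodRoot.

(** * Checking an explicit decomposition *)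

Section ExplicitTree.
Variables (n : nat) (e : rel nat).
Notation D := (mask_digraph n e).
Variables (tree : seq (nat * seq nat)) (r : nat).
Notation M := (size tree).

(* Node [v < n] has bag [{v}], the other nodes have empty bags; [tree] lists,
   for every node, its parent and the guard of the edge that enters it. *)
Definition parent (t : nat) : nat := (nth (0, [::]) tree t).1.
Definition entry_guard (t : nat) : seq nat := (nth (0, [::]) tree t).2.

Definition ancestor (t v : nat) : bool := t \in traject parent v M.

(** [c] is the part below [t], [x] the guard above it, and [w] the first vertex of [c]. The test on
    [parent t] makes the bounded relation [ancestor] pass up the tree, so that it agrees with
    reachability. *)
Definition node_ok (t : nat) : bool :=
  let c := mkseq (ancestor t) n in
  let x := mkseq (mem (entry_guard t)) n in
  let w := index true c in
  [&& parent t < M, w < n, ~~ nth false x w,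
      all (fun v => ancestor t v ==> ancestor (parent t) v) (iota 0 n),
      within c (scc_mask n (out_rows n e) (in_rows n e) (compl_mask n x) w)
    & within (scc_mask n (out_rows n e) (in_rows n e) (compl_mask n x) w) c].

Definition in_Gamma (t v : nat) : bool :=
  [|| v == t, (t != r) && (v \in entry_guard t)
    | has (fun s => [&& s != r, parent s == t & v \in entry_guard s]) (iota 0 M)].

Definition tree_check (k : nat) : bool :=
  [&& r < n <= M, M <= n ^ 2, parent r == r,
      all (fun t => (t == r) || node_ok t) (iota 0 M),
      all (ancestor r) (iota 0 M)
    & all (fun t => count (in_Gamma t) (iota 0 n) <= k) (iota 0 M)].

Lemma explicit_decomposition k : tree_check k ->
  exists2 A : decomposition D, SC_decomposition A & width A <= k.-1.
Proof.
case/and5P => /andP[ltrn lenM] leM Dr /allP nodes /andP[/allP anc_r /allP Gk].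
have ltrM := leq_trans ltrn lenM.
have anc_refl v : ancestor v v.
  by rewrite /ancestor; case: (M) ltrM => // M' _; rewrite inE eqxx.
pose te : rel 'I_M := [rel s t : 'I_M | (t != r :> nat) && (s == parent t :> nat)].
pose bg (t : 'I_M) : {set D} := [set v : 'I_n | v == t :> nat].
pose gd (_ t : 'I_M) : {set D} := [set v : 'I_n | (v : nat) \in entry_guard t].
have mem_iotaM (t : 'I_M) : (t : nat) \in iota 0 M by rewrite mem_iota /=.
have parM (t : 'I_M) : t != r :> nat -> parent t < M.
  by move=> tr; have := nodes t (mem_iotaM t); rewrite (negPf tr) => /and3P[].
have conn_iter j (s t : 'I_M) : iter j parent t = s -> connect te s t.
  elim: j t => [|j IHj] t; first by move/val_inj->.
  rewrite iterSr; have [Dt | tr] := eqVneq (t : nat) r.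
    by rewrite Dt (eqP Dr) -Dt; apply: IHj.
  move=> Ds; apply: connect_trans (IHj (Ordinal (parM t tr)) Ds) (connect1 _).
  by apply/andP; split; rewrite /=.
have te_tree : rooted_tree (Ordinal ltrM) te.
  split=> [s | t tr | t].
  - by apply/negP => /andP[/eqP].
  - rewrite -(cards1 (Ordinal (parM t tr))); apply: eq_card => s.
    by rewrite !inE; apply/andP/eqP => [[_ /eqP Ds] | ->]; [apply: val_inj | split=> /=].
  - have /trajectP[j _ Dj] := anc_r t (mem_iotaM t).
    exact: (conn_iter j).
have bg_cover : \bigcup_t bg t = [set: D].
  apply/setP => v; rewrite inE; apply/bigcupP.
  by exists (Ordinal (leq_trans (ltn_ord v) lenM)); rewrite ?inE.
pose A := Decomposition gd te_tree bg_cover.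
exists A.
  split=> //.
  - move=> s t st; rewrite -setI_eq0; apply/eqP/setP => v; rewrite !inE.
    by apply/negP => /andP[/eqP vs /eqP vt]; case/eqP: st; apply: ord_inj; rewrite -vs.
  - by apply/set0Pn; exists (Ordinal ltrn); rewrite inE.
  - move=> s t /andP[tr _]; have := nodes t (mem_iotaM t); rewrite (negPf tr) orFb /node_ok.
    set c := mkseq _ n; set x := mkseq _ n; set w := index _ _.
    case/and5P => _ ltwn wx /allP anc_par /andP[/withinP c_scc /withinP scc_c].
    have Dx : gd s t = vset n x by apply/setP => v; rewrite !inE nth_mkseq.
    have Dc : subtree_bag (t : node A) = vset n c.
      apply/setP => v; rewrite inE nth_mkseq //; set u := widen_ord lenM v.
      apply/subtree_bagP/idP => [[t' /connectP[p]] | /trajectP[j _ Dj]]; last first.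
        by exists u; [apply: (conn_iter j) | rewrite inE].
      rewrite inE; elim: p (t) => [|y p IHp] z /= => [_ -> /eqP Dv | /andP[/andP[yr /eqP ->] yp] Dt' vt'].
        by rewrite Dv anc_refl.
      have := nodes y (mem_iotaM y); rewrite (negPf yr) => /and5P[_ _ _ /allP/(_ v) anc_y _].
      by move: anc_y; rewrite mem_iota /= ltn_ord => /(_ isT)/implyP; apply; apply: IHp yp Dt' vt'.
    have wX : Ordinal ltwn \notin (vset n x : {set D}) by rewrite inE.
    rewrite -[guard _ _]/(gd s t) Dx Dc; suff -> : vset n c = scc (vset n x : {set D}) (Ordinal ltwn).
      exact: scc_strong_component.
    rewrite -vset_scc //; apply/setP => v; rewrite !inE.
    by apply/idP/idP; [apply: c_scc | apply: scc_c].
  - by rewrite !card_ord.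
rewrite /width -!subn1 leq_sub2r //; apply/bigmax_leqP => t _.
apply: leq_trans (Gk t (mem_iotaM t)); rewrite -val_enum_ord count_map -size_filter.
rewrite cardE; apply: uniq_leq_size => [|v]; first exact: enum_uniq.
rewrite mem_enum mem_filter mem_enum /= !inE andbT -orbA /in_Gamma.
case/or3P => [-> // | /bigcupP[s /andP[tr _]] | /bigcupP[s /andP[sr /eqP Ds]]].
  by rewrite inE tr => ->; rewrite orbT.
rewrite inE => vs; apply/or3P/Or33/hasP; exists (s : nat) => //.
by rewrite sr -Ds eqxx.
Qed.

End ExplicitTree.

(** * The two digraphs *)

(** Descent on the width; whether a narrower decomposition exists is decided by excluded middle. *)
Lemma SC_width_exists (D : digraph) (A : decomposition D) :
  SC_decomposition A -> exists2 k, SC_width D k & k <= width A.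
Proof.
have [m] := ubnP (width A); elim: m A => // m IHm A le_m A_SC.
have [[B [B_SC lt_BA]] | minA] :=
    classic (exists B : decomposition D, SC_decomposition B /\ width B < width A).
  have [k Dk le_kB] := IHm B (leq_trans lt_BA le_m) B_SC.
  by exists k => //; apply: leq_trans le_kB (ltnW lt_BA).
exists (width A) => //; split=> [|B B_SC]; first by exists A.
by rewrite leqNgt; apply/negP => lt_BA; apply: minA; exists B.
Qed.

Lemma SC_decomposition_exists (D : digraph) : 0 < #|D| ->
  exists A : decomposition D, SC_decomposition A.
Proof.
move=> D_gt0.
(* A single node whose bag holds all the vertices. *)
have one_tree : rooted_tree tt (fun _ _ : unit => false).
  by split=> [] // [] //; apply: connect0.
have one_cover : \bigcup_(t : unit) [set: D] = [set: D].
  by apply/setP => v; rewrite inE; apply/bigcupP; exists tt.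
exists (Decomposition (fun _ _ => set0) one_tree one_cover); split=> //.
- by change ([set: D] != set0); rewrite -card_gt0 cardsT.
- by rewrite card_unit expn_gt0 D_gt0.
Qed.

(* The sets 0..6, 7..10, 11..14 and 15..21 carry strips of triangles with edges in
   both directions; the edges [3 -> 10], [14 -> 18] and [6 -> 21] lead forward
   from one set to a later one, all the other edges lead backward. *)
Definition adjacency : seq (seq nat) :=
  [:: [:: 1; 2; 4; 5]; [:: 0; 2; 3]; [:: 0; 1; 3]; [:: 1; 2; 10];
      [:: 0; 5; 6]; [:: 0; 4; 6]; [:: 4; 5; 21];
      [:: 0; 1; 4; 8; 9]; [:: 0; 1; 4; 7; 9; 10]; [:: 7; 8; 10]; [:: 8; 9];
      [:: 1; 12; 13]; [:: 11; 13; 14]; [:: 11; 12; 14]; [:: 12; 13; 18];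
      [:: 7; 11; 12; 16; 17; 19; 20]; [:: 7; 11; 12; 15; 17; 18]; [:: 15; 16; 18];
      [:: 16; 17]; [:: 7; 11; 12; 15; 20; 21]; [:: 15; 19; 21]; [:: 19; 20]].

Definition arc (i j : nat) : bool := j \in nth [::] adjacency i.

(* Node [v <= 22] has bag [{v}], nodes 23, 24, 25 have empty bags; the root is 22.
   The subtrees of 23, 24, 25 cover [V(D')], [C1], [C2]. *)
Definition small_tree : seq (nat * seq nat) :=
  [:: (24, [:: 10; 21]); (0, [:: 0; 10]); (1, [:: 0; 1]); (2, [:: 1; 2]);
      (0, [:: 0; 21]); (4, [:: 0; 4]); (5, [:: 4; 5]);
      (24, [:: 3; 21]); (7, [:: 3; 7]); (8, [:: 7; 8]); (9, [:: 8; 9]);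
      (25, [:: 6; 18]); (11, [:: 11; 18]); (12, [:: 11; 12]); (13, [:: 12; 13]);
      (25, [:: 6; 14]); (15, [:: 14; 15]); (16, [:: 15; 16]); (17, [:: 16; 17]);
      (15, [:: 6; 15]); (19, [:: 15; 19]); (20, [:: 19; 20]);
      (22, [::]); (22, [::]); (23, [:: 21]); (23, [:: 6])].

Lemma small_tree_ok : tree_check 23 arc small_tree 22 3.
Proof. by vm_compute. Qed.

(** Five rounds over all guards of at most 3 vertices reach a closed table; three guarding vertices
    correspond to width 2, which is thereby excluded. *)
Lemma arc_no_good_root : no_good_root 22 arc 5 3.
Proof. by vm_compute. Qed.

Theorem theorem4p12 :
  exists D D' : digraph,
    butterfly_minor D' D /\
    exists k k' : nat, [/\ SC_width D k, SC_width D' k' & k < k'].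
Proof.
pose D' := mask_digraph 22 arc; exists (mask_digraph 23 arc), D'; split.
  (* [D'] is a subgraph of [D], so no contraction takes place. *)
  exists D'; last by apply: Contracts_iso; exists id; first by exists id.
  by exists (widen_ord (leqnSn 22)) => // i j /(congr1 val) /= ij; apply: val_inj.
have [A A_SC A2] := explicit_decomposition small_tree_ok.
have [k Dk le_kA] := SC_width_exists A_SC.
have [|B B_SC] := @SC_decomposition_exists D'; first by rewrite card_ord.
have [k' Dk' _] := SC_width_exists B_SC.
exists k, k'; split=> //; have [[C C_SC <-] _] := Dk'.
(* [k <= 2], while every decomposition of [D'] has width at least 3. *)
apply: leq_ltn_trans (leq_trans le_kA A2) _.
exact: no_good_root_width arc_no_good_root C C_SC.
Qed.
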